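(* Let $m\ge1$, $n\ge1$, $N>2n$, let $\Sigma_0,\dots,\Sigma_n\in\mathbb R^{m\times m}$ and let $\mathbf T_n$ be the block-Toeplitz matrix whose $(i,j)$ block ($i,j=0,\dots,n$) is $\Sigma_{i-j}$ if $i\ge j$ and $\Sigma_{j-i}^\top$ if $i<j$. Assume there exists a symmetric positive definite $mN\times mN$ matrix $\bar{\boldsymbol\Sigma}_N$ with $E_n^\top\bar{\boldsymbol\Sigma}_NE_n=\mathbf T_n$ and $\mathbf U_N^\top\bar{\boldsymbol\Sigma}_N\mathbf U_N=\bar{\boldsymbol\Sigma}_N$. Then the function $$J(\Lambda,\Theta)=\operatorname{Tr}(\Lambda\mathbf T_n)-\log\det\left(E_n\Lambda E_n^\top+\mathbf U_N\Theta\mathbf U_N^\top-\Theta\right)$$ admits a unique minimum point $(\bar\Lambda,\bar\Theta)$ in $\mathcal L_+$.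
   Context: $\mathfrak S_k$ denotes the space of real symmetric $mk\times mk$ matrices. $E_n$ is the $mN\times m(n+1)$ matrix with $N\times(n+1)$ blocks of size $m\times m$ whose $(i,i)$ blocks ($i=1,\dots,n+1$) are $I_m$ and other blocks $0$. $\mathbf U_N$ is the $mN\times mN$ block shift matrix whose $(i,i+1)$ blocks ($i=1,\dots,N-1$) and $(N,1)$ block are $I_m$, others $0$. The linear map $A:\mathfrak S_{n+1}\times\mathfrak S_N\to\mathfrak S_N$ is $A(\Lambda,\Theta)=E_n\Lambda E_n^\top+\mathbf U_N\Theta\mathbf U_N^\top-\Theta$, and $\mathcal L_+=\{(\Lambda,\Theta)\in(\ker A)^\perp: A(\Lambda,\Theta)>0\}$, where orthogonality in $\mathfrak S_{n+1}\times\mathfrak S_N$ is with respect to the inner product $\langle(\Lambda_1,\Theta_1),(\Lambda_2,\Theta_2)\rangle=\operatorname{Tr}(\Lambda_1\Lambda_2)+\operatorname{Tr}(\Theta_1\Theta_2)$. *)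

(* Defs.v *)
From HB Require Import structures.
From mathcomp Require Import all_boot all_order all_algebra.
From mathcomp Require Import reals exp.
Set Implicit Arguments. Unset Strict Implicit. Unset Printing Implicit Defensive.
Import Order.TTheory GRing.Theory Num.Theory.
Local Open Scope ring_scope.

Section Defs.
Variable R : realType.

(* Scalar index k of an mK-dimensional space is in block k %/ m, position k %% m. *)

Definition Emat (m n N : nat) : 'M[R]_(m * N, m * n.+1) :=
  \matrix_(i, j) ((i : nat) == (j : nat))%:R.

(* U_N : mN x mN block shift; 0-based block (i, i+1 mod N) is I_m. *)
Definition Umat (m N : nat) : 'M[R]_(m * N) :=
  \matrix_(i, j) (((i %% m) == (j %% m)) && ((j %/ m) == (i %/ m).+1 %% N))%N%:R.

Definition ent (m : nat) (A : 'M[R]_m) (r s : nat) : R :=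
  match insub r, insub s with
  | Some r', Some s' => A r' s'
  | _, _ => 0
  end.

Definition Toep (m n : nat) (S : 'I_n.+1 -> 'M[R]_m) : 'M[R]_(m * n.+1) :=
  \matrix_(i, j)
    if (j %/ m <= i %/ m)%N
    then ent (S (inord (i %/ m - j %/ m)%N)) (i %% m)%N (j %% m)%N
    else ent ((S (inord (j %/ m - i %/ m)%N))^T) (i %% m)%N (j %% m)%N.

Definition symmx (k : nat) (A : 'M[R]_k) : Prop := A^T = A.

Definition posdef (k : nat) (A : 'M[R]_k) : Prop :=
  A^T = A /\ forall x : 'cV[R]_k, x != 0 -> 0 < (x^T *m A *m x) ord0 ord0.

Definition Amap (m n N : nat) (L : 'M[R]_(m * n.+1)) (T : 'M[R]_(m * N))
  : 'M[R]_(m * N) :=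
  Emat m n N *m L *m (Emat m n N)^T + Umat m N *m T *m (Umat m N)^T - T.

Definition in_ker_perp (m n N : nat) (L : 'M[R]_(m * n.+1)) (T : 'M[R]_(m * N))
  : Prop :=
  symmx L /\ symmx T /\
  forall (L' : 'M[R]_(m * n.+1)) (T' : 'M[R]_(m * N)),
    symmx L' -> symmx T' -> Amap L' T' = 0 ->
    \tr (L *m L') + \tr (T *m T') = 0.

Definition Lplus (m n N : nat) (L : 'M[R]_(m * n.+1)) (T : 'M[R]_(m * N))
  : Prop := in_ker_perp L T /\ posdef (Amap L T).

Definition Jfun (m n N : nat) (Tn : 'M[R]_(m * n.+1))
  (L : 'M[R]_(m * n.+1)) (T : 'M[R]_(m * N)) : R :=
  \tr (L *m Tn) - ln (\det (Amap L T)).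

End Defs.

(* Main.v *)
(** Write M for the matrix A(Lambda, Theta).  Shift invariance of the given
    extension Sb gives J = tr(M Sb) - ln det M, so the problem is to minimise this
    function over the positive definite elements of the linear space V = range A, which
    A maps the orthogonal complement of its kernel onto bijectively.  Feasibility is
    explicit: the identity lies in V.

    Existence: a Cholesky factor of Sb reduces to Sb = I.  The determinant attains a
    maximum on the compact set of positive semidefinite M in V of trace 1, and the best
    multiple of that maximiser is the minimiser sought.

    Uniqueness: if A1 and A2 are minimisers, factor their midpoint as C C^T and conjugate
    by the inverse of C, turning A1 and A2 into X and Y with X + Y = 2 I.  As
    ln det X <= tr X - k with equality only at X = I, minimality forces X = Y = I. *)

Require Import Defs.
From HB Require Import structures.
From mathcomp Require Import all_boot all_order all_algebra.
From mathcomp Require Import all_classical all_reals all_analysis.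
From mathcomp Require Import perm ring lra.
Set Implicit Arguments. Unset Strict Implicit. Unset Printing Implicit Defensive.
Import Order.TTheory GRing.Theory Num.Theory numFieldNormedType.Exports.
Local Open Scope ring_scope.

(** * Cholesky factorisation and strict concavity of [ln det] *)

Lemma ln_le_subr1 (R : realType) (t : R) : 0 < t -> ln t <= t - 1.
Proof. by move=> t0; rewrite -[X in ln X](subrKC 1 t); apply: le_ln1Dx; lra. Qed.

Lemma ln_eq_subr1 (R : realType) (t : R) : 0 < t -> ln t = t - 1 -> t = 1.
Proof.
move=> t0 e; apply/eqP; rewrite -(ln_eq0 t0); apply: contra_eqT e => nz.
by have := expR_gt1Dx nz; rewrite lnK ?posrE // => h; apply/eqP; lra.
Qed.

Lemma ln_prod (R : realType) (I : Type) (r : seq I) (F : I -> R) :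
  (forall i, 0 < F i) -> ln (\prod_(i <- r) F i) = \sum_(i <- r) ln (F i).
Proof.
move=> F0; elim: r => [|i r ih]; first by rewrite !big_nil ln1.
by rewrite !big_cons lnM ?ih // posrE // prodr_gt0.
Qed.

(** Induction on the size: split off the top left entry [a], factor its Schur complement [S], and
    border that factor with the column [(sqrt a, b / sqrt a)]. *)
Lemma posdef_cholesky (R : realType) k (X : 'M[R]_k) : posdef X ->
  exists C : 'M[R]_k, [/\ is_trig_mx C, (forall i, 0 < C i i) & X = C *m C^T].
Proof.
elim: k X => [|k ih] X [sX pX].
  by exists 0; split=> [||]; [exact: mx0_is_trig | case | rewrite !thinmx0].
rewrite -[k.+1]/(1 + k)%N in X sX pX *.
pose a := ulsubmx X 0 0; pose b := dlsubmx X; pose D := drsubmx X.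
have EX : X = block_mx a%:M b^T b D.
  by rewrite /b trmx_dlsub sX -mx11_scalar submxK.
have a0 : 0 < a.
  have nz : col_mx (1 : 'M[R]_1) (0 : 'M[R]_(k, 1)) != 0.
    by rewrite col_mx_eq0 negb_and oner_neq0.
  move: (pX _ nz); rewrite {1}EX tr_col_mx mul_row_block trmx0 trmx1.
  by rewrite !mul1mx !mul0mx !addr0 mul_row_col mulmx1 mulmx0 addr0 mxE eqxx.
have an0 : a != 0 by rewrite gt_eqF.
pose S := D - a^-1 *: (b *m b^T).
have sD : D^T = D by rewrite /D trmx_drsub sX.
have pS : posdef S.
  split; first by rewrite linearB linearZ /= trmx_mul trmxK sD.
  (* The top entry of [x] is chosen so that [X *m x] has zero top entry; the form of [X] at [x] is
     then the form of [S] at [y]. *)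
  move=> y y0; pose x := col_mx (- a^-1 *: (b^T *m y)) y.
  have x0 : x != 0 by rewrite col_mx_eq0 negb_and y0 orbT.
  move: (pX x x0); rewrite -mulmxA {1}EX mul_block_col.
  rewrite mul_scalar_mx scalerA mulrN divff // scaleN1r addNr.
  rewrite tr_col_mx mul_row_col mulmx0 add0r -scalemxAr -mulmxA.
  by rewrite mulmxBl -scalemxAl -mulmxA scaleNr addrC mulmxA.
have [C [tC dC SC]] := ih _ pS.
pose c := Num.sqrt a.
have c0 : 0 < c by rewrite sqrtr_gt0.
exists (block_mx (c%:M : 'M[R]_1) 0 (c^-1 *: b) C); split.
- by rewrite is_trig_block_mx // eqxx tC scalar_mx_is_trig.
- move=> i; rewrite -(splitK i); case: (fintype.split i) => j.
    by rewrite block_mxEul ord1 mxE eqxx.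
  by rewrite block_mxEdr.
have cc : c * c = a by rewrite -expr2 sqr_sqrtr // ltW.
rewrite EX tr_block_mx mulmx_block !trmx0 !mulmx0 !mul0mx !addr0 -SC tr_scalar_mx.
rewrite -scalar_mxM cc [(c^-1 *: b)^T]linearZ /=.
rewrite mul_scalar_mx mul_mx_scalar !scalerA divff ?gt_eqF // !scale1r.
rewrite -scalemxAl -scalemxAr scalerA -invfM cc.
by rewrite /S addrC subrK.
Qed.

(** With [X = C *m C^T] and [C] triangular, the determinant is the product of the [C i i ^+ 2] and
    the trace is the sum of all squared entries. The gap is thus a sum over rows of
    [C i i ^+ 2 - 1 - ln (C i i ^+ 2)] plus off-diagonal squares, all nonnegative. *)
Lemma ln_det_le_tr (R : realType) k (X : 'M[R]_k) : posdef X ->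
  ln (\det X) <= \tr X - k%:R /\ (ln (\det X) = \tr X - k%:R -> X = 1%:M).
Proof.
move=> /posdef_cholesky [C [tC dC ->]].
have dsq i : 0 < C i i ^+ 2 by rewrite exprn_gt0.
have -> : \det (C *m C^T) = \prod_i (C i i ^+ 2).
  rewrite det_mulmx det_tr det_trig // -big_split.
  by apply: eq_bigr => i _; rewrite expr2.
have -> : \tr (C *m C^T) - k%:R = \sum_i (\sum_j C i j ^+ 2 - 1).
  rewrite sumrB sumr_const card_ord; congr (_ - _).
  by apply: eq_bigr => i _; rewrite mxE; apply: eq_bigr => j _; rewrite mxE expr2.
rewrite ln_prod //.
have rest i : 0 <= \sum_(j | j != i) C i j ^+ 2.
  by apply: sumr_ge0 => j _; rewrite sqr_ge0.
have term i : 0 <= \sum_j C i j ^+ 2 - 1 - ln (C i i ^+ 2).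
  by rewrite (bigD1 i) //=; have := rest i; have := ln_le_subr1 (dsq i); lra.
split=> [|/esym/eqP]; first by rewrite -subr_ge0 -sumrB; exact: sumr_ge0.
rewrite -subr_eq0 -sumrB => /eqP e.
suff -> : C = 1%:M by rewrite trmx1 mulmx1.
(* In the equality case each row term vanishes, which kills the off-diagonal entries and forces the
   positive diagonal entries to be 1. *)
have h i : \sum_j C i j ^+ 2 - 1 - ln (C i i ^+ 2) = 0.
  by apply: (psumr_eq0P _ e).
apply/matrixP => i j; rewrite mxE.
move: (h i) (rest i) (ln_le_subr1 (dsq i)); rewrite (bigD1 i) //=.
set s := \sum_(_ | _) _ => h1 h2 h3.
have s0 : s = 0 by lra.
have /ln_eq_subr1 : ln (C i i ^+ 2) = C i i ^+ 2 - 1 by lra.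
move=> /(_ (dsq i))/eqP; rewrite sqrp_eq1 ?ltW // => /eqP cii.
have [<-|ij] := eqVneq i j; first by rewrite cii.
have : C i j ^+ 2 = 0.
  by apply: (psumr_eq0P (fun l _ => sqr_ge0 (C i l)) s0); rewrite eq_sym.
by move/eqP; rewrite sqrf_eq0 => /eqP.
Qed.

Lemma posdef_factor (R : realType) k (X : 'M[R]_k) : posdef X ->
  exists2 C : 'M[R]_k, C \in unitmx & X = C *m C^T.
Proof.
move=> /posdef_cholesky [C [tC dC eX]]; exists C => //.
by rewrite unitmxE det_trig // unitfE gt_eqF // prodr_gt0.
Qed.

Lemma posdef_det_gt0 (R : realType) k (X : 'M[R]_k) : posdef X -> 0 < \det X.
Proof.
move=> /posdef_factor [C uC ->]; rewrite det_mulmx det_tr -expr2.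
by rewrite exprn_even_gt0 //= -unitfE -unitmxE.
Qed.

Lemma posdef_congr (R : realType) k (A C : 'M[R]_k) :
  posdef A -> C \in unitmx -> posdef (C *m A *m C^T).
Proof.
move=> [sA pA] uC; split; first by rewrite !trmx_mul trmxK sA mulmxA.
move=> x x0; have y0 : C^T *m x != 0.
  apply: contra_neq x0 => e; rewrite -(@mulKmx _ _ _ C^T _ x) ?unitmx_tr //.
  by rewrite e mulmx0.
by have := pA _ y0; rewrite trmx_mul trmxK !mulmxA.
Qed.

Lemma posdef_comb (R : realType) k (a b : R) (A B : 'M[R]_k) :
  0 < a -> 0 <= b -> posdef A -> posdef B -> posdef (a *: A + b *: B).
Proof.
move=> a0 b0 [sA pA] [sB pB]; split; first by rewrite linearD !linearZ /= sA sB.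
move=> x x0; rewrite mulmxDr mulmxDl -!scalemxAr -!scalemxAl mxE.
rewrite [X in X + _]mxE [X in _ + X]mxE ltr_pwDl ?mulr_gt0 ?pA //.
by rewrite mulr_ge0 // ltW // pB.
Qed.

Lemma posdef_scale (R : realType) k (a : R) (A : 'M[R]_k) :
  0 < a -> posdef A -> posdef (a *: A).
Proof.
by move=> a0 pA; have := posdef_comb a0 (lexx 0) pA pA; rewrite scale0r addr0.
Qed.

Lemma ln_det_congr (R : realType) k (A C : 'M[R]_k) : posdef A -> C \in unitmx ->
  ln (\det (C *m A *m C^T)) = ln (\det A) + ln (\det C ^+ 2).
Proof.
move=> pA uC; rewrite !det_mulmx det_tr mulrAC -expr2 mulrC lnM // posrE.
  exact: posdef_det_gt0.
by rewrite exprn_even_gt0 //= -unitfE -unitmxE.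
Qed.

(** Strict concavity of [ln det]: a congruence turns the midpoint into the identity, where the trace
    bound applies to both endpoints at once. *)
Lemma ln_det_midpoint (R : realType) k (A B : 'M[R]_k) : posdef A -> posdef B ->
  2 * ln (\det (2^-1 *: A + 2^-1 *: B)) <= ln (\det A) + ln (\det B) -> A = B.
Proof.
move=> pA pB; set M := _ + _ => le_M.
have pM : posdef M by apply: posdef_comb => //; lra.
have [C uC eM] := posdef_factor pM.
pose D := invmx C; have uD : D \in unitmx by rewrite unitmx_inv.
have DM : D *m M *m D^T = 1%:M.
  by rewrite eM mulmxA mulVmx // mul1mx -trmx_mul mulVmx // trmx1.
have := ln_det_congr pM uD; rewrite DM det1 ln1 => lnM0.
have [leA eqA] := ln_det_le_tr (posdef_congr pA uD).
have [leB eqB] := ln_det_le_tr (posdef_congr pB uD).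
have tr2 : \tr (D *m A *m D^T) + \tr (D *m B *m D^T) = 2 * k%:R.
  rewrite -(mxtrace1 R k) -DM /M mulmxDr mulmxDl linearD /=.
  by rewrite -!scalemxAr -!scalemxAl !linearZ /=; field.
rewrite !ln_det_congr // in leA leB eqA eqB.
(* The two trace bounds have right-hand sides summing to 0, while [le_M] makes the left-hand sides
   sum to at least 0. Both bounds are therefore equalities, and both conjugates are the identity. *)
have tight (l a b c s t : R) : 0 = l + c -> 2 * l <= a + b -> a + c <= s - k%:R ->
    b + c <= t - k%:R -> s + t = 2 * k%:R -> a + c = s - k%:R.
  by lra.
have XY : D *m A *m D^T = D *m B *m D^T.
  rewrite eqA; first rewrite eqB //.
    by apply: tight lnM0 _ leB leA _; rewrite addrC.
  exact: tight lnM0 le_M leA leB tr2.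
apply: (can_inj (mulKmx uD)); apply: (can_inj (mulmxK _)) XY.
by rewrite unitmx_tr.
Qed.

(** * Existence of a minimiser *)

Definition possemidef (R : realType) k (A : 'M[R]_k) : Prop :=
  A^T = A /\ forall x : 'cV[R]_k, 0 <= (x^T *m A *m x) ord0 ord0.

Lemma posdef_semidef (R : realType) k (A : 'M[R]_k) : posdef A -> possemidef A.
Proof.
move=> [sA pA]; split=> // x; have [->|/pA/ltW//] := eqVneq x 0.
by rewrite mulmx0 mxE.
Qed.

(** The test point [t = n / (q + 1)] makes the expression a negative multiple of [n ^+ 2]; the shift
    by 1 also covers [q = 0]. *)
Lemma quadratic_nonneg_lin0 (R : realFieldType) (n q : R) : 0 <= q ->
  (forall t, 0 <= - 2 * t * n + t ^+ 2 * q) -> n = 0.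
Proof.
move=> q0 /(_ (n / (q + 1))).
have -> : - 2 * (n / (q + 1)) * n + (n / (q + 1)) ^+ 2 * q
    = - (n ^+ 2 * ((q + 2) / (q + 1) ^+ 2)) by field; lra.
rewrite oppr_ge0 pmulr_lle0; last by rewrite divr_gt0 ?exprn_gt0 //; lra.
by move=> n2; apply/eqP; rewrite -sqrf_eq0 eq_le sqr_ge0 andbT.
Qed.

(** A vector [x] on which a semidefinite form vanishes lies in the kernel: with [y = A *m x],
    nonnegativity at every [x - t *: y] forces [y = 0]. *)
Lemma possemidef_posdef (R : realType) k (A : 'M[R]_k) :
  possemidef A -> \det A != 0 -> posdef A.
Proof.
move=> [sA pA] dA; split=> // x x0; rewrite lt_neqAle pA andbT eq_sym.
apply: contra_neq x0 => qx.
have uA : A \in unitmx by rewrite unitmxE unitfE.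
pose y := A *m x.
suff y0 : y = 0 by rewrite -(mulKmx uA x) -/y y0 mulmx0.
pose n := (y^T *m y) 0 0.
pose q := (y^T *m A *m y) 0 0.
have h (t : R) : 0 <= - 2 * t * n + t ^+ 2 * q.
  have := pA (x - t *: y); suff -> : (((x - t *: y)^T *m A *m (x - t *: y)) 0 0)
    = - 2 * t * n + t ^+ 2 * q by [].
  have xy : x^T *m A *m y = y^T *m y by rewrite /y trmx_mul sA.
  have yx : y^T *m A *m x = y^T *m y by rewrite -mulmxA.
  have -> : (x - t *: y)^T = x^T - t *: y^T by rewrite linearB linearZ.
  rewrite !mulmxBl !mulmxBr -!scalemxAl -!scalemxAr xy yx.
  have mxB (U V : 'M[R]_1) : (U - V) 0 0 = U 0 0 - V 0 0 by rewrite !mxE.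
  have mxS c (U : 'M[R]_1) : (c *: U) 0 0 = c * U 0 0 by rewrite !mxE.
  by rewrite !mxB !mxS qx -/n -/q; ring.
have {h} n0 : n = 0 by apply: quadratic_nonneg_lin0 h; exact: pA.
apply/colP => i; rewrite [RHS]mxE; apply/eqP; rewrite -sqrf_eq0; apply/eqP.
move: n0; rewrite /n mxE => n0.
rewrite expr2 -(psumr_eq0P _ n0 (i := i)) ?mxE // => j _.
by rewrite mxE -expr2 sqr_ge0.
Qed.

(** The form at [e i + e j] and at [e i - e j] bounds [|A i j|] by the mean of two diagonal entries,
    each at most the trace. *)
Lemma possemidef_entry_bound (R : realType) k (A : 'M[R]_k) :
  possemidef A -> forall i j, `|A i j| <= \tr A.
Proof.
move=> [sA pA] i j; pose e i : 'cV[R]_k := delta_mx i 0.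
have ee a b : ((e a)^T *m A *m e b) 0 0 = A a b.
  by rewrite trmx_delta -rowE -colE !mxE.
have dA a : 0 <= A a a by rewrite -ee.
have le_tr a : A a a <= \tr A.
  by rewrite /mxtrace (bigD1 a) //= lerDl sumr_ge0.
have ji : A j i = A i j by rewrite -{1}sA mxE.
have mxD (U V : 'M[R]_1) : (U + V) 0 0 = U 0 0 + V 0 0 by rewrite !mxE.
have mxS c (U : 'M[R]_1) : (c *: U) 0 0 = c * U 0 0 by rewrite !mxE.
have h (s : R) : 0 <= A i i + s * A i j + (s * A i j + s ^+ 2 * A j j).
  have := pA (e i + s *: e j).
  have -> : (e i + s *: e j)^T = (e i)^T + s *: (e j)^T by rewrite linearD linearZ.
  rewrite !mulmxDl !mulmxDr -!scalemxAl -!scalemxAr.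
  by rewrite !mxD !mxS !ee ji mulrA -expr2.
have := h 1; have := h (-1); have := le_tr i; have := le_tr j.
rewrite ler_norml; set t := \tr A => *; apply/andP; split; lra.
Qed.

Lemma sum_continuous (R : realType) (T : topologicalType) (I : Type) (r : seq I)
  (F : I -> T -> R) : (forall i, continuous (F i)) ->
  continuous (fun x => \sum_(i <- r) F i x).
Proof. by move=> cF; apply: continuous_big => //; exact: add_continuous. Qed.

Lemma prod_continuous (R : realType) (T : topologicalType) (I : Type) (r : seq I)
  (F : I -> T -> R) : (forall i, continuous (F i)) ->
  continuous (fun x => \prod_(i <- r) F i x).
Proof. by move=> cF; apply: continuous_big => //; exact: mul_continuous. Qed.

Lemma continuousMc (R : realType) (T : topologicalType) (f : T -> R) (c : R) :
  continuous f -> continuous (fun x => f x * c).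
Proof. by move=> cf x; apply: cvgM; [exact: cf | exact: cvg_cst]. Qed.

Lemma vec_mx_entry_continuous (R : realType) k (i j : 'I_k) :
  continuous (fun v : 'rV[R]_(k * k) => vec_mx v i j).
Proof.
have -> : (fun v : 'rV[R]_(k * k) => vec_mx v i j) = fun v => v 0 (mxvec_index i j).
  by apply/funext => v; rewrite mxE.
exact: coord_continuous.
Qed.

(** The kernel of [B] encodes an arbitrary linear space of matrices, flattened to row vectors. The
    slice is an intersection of closed conditions, and trace 1 confines all entries to [[-1, 1]]. *)
Lemma compact_possemidef_slice (R : realType) k p (B : 'M[R]_(k * k, p)) :
  compact [set v : 'rV[R]_(k * k) |
    [/\ possemidef (vec_mx v), v *m B = 0 & \tr (vec_mx v) = 1]]%classic.
Proof.
apply: subclosed_compact (rV_compact (fun _ => @segment_compact R (-1) 1)) _.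
  pose qf (x : 'cV[R]_k) (v : 'rV[R]_(k * k)) := (x^T *m vec_mx v *m x) 0 0.
  rewrite (_ : [set _ | _]%classic =
     ((\bigcap_(ij in setT)
        (fun v => vec_mx v ij.1 ij.2 - vec_mx v ij.2 ij.1) @^-1` [set x | x = 0])
     `&` (\bigcap_(x in setT) (qf x) @^-1` [set y | 0 <= y])
     `&` (\bigcap_(j in setT) (fun v => (v *m B) 0 j) @^-1` [set x | x = 0])
     `&` ((fun v => \tr (vec_mx v)) @^-1` [set x | x = 1]))%classic); last first.
    apply/seteqP; split=> v /=.
      move=> [[sv pv] vB tv]; split=> //; split; [split|].
      - by move=> [i j] _ /=; rewrite -{1}sv mxE subrr.
      - by move=> x _; exact: pv.
      - by move=> j _ /=; rewrite vB mxE.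
    move=> [[[sv pv] vB] tv]; split=> //.
      split=> [|x]; last exact: pv.
      by apply/matrixP => i j; rewrite mxE; apply/subr0_eq; exact: (sv (j, i)).
    by apply/rowP => j; rewrite [RHS]mxE; exact: vB.
  have cl (f : 'rV[R]_(k * k) -> R) D : closed D -> continuous f -> closed (f @^-1` D).
    by move=> cD cf; apply: (preimage_closed _ cD) => x _; exact: cf.
  apply: closedI; [apply: closedI; [apply: closedI|]|].
  - apply: closed_bigI => -[i j] _; apply: cl; [exact: closed_eq|] => x.
    exact: cvgB (@vec_mx_entry_continuous _ _ _ _ x)
      (@vec_mx_entry_continuous _ _ _ _ x).
  - apply: closed_bigI => x _; apply: cl; first exact: closed_ge.
    rewrite /qf (_ : (fun _ => _) = fun v => \sum_j (\sum_i vec_mx v i j * x i 0) * x j 0).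
      apply: sum_continuous => j; apply: continuousMc; apply: sum_continuous => i.
      by apply: continuousMc; exact: vec_mx_entry_continuous.
    apply/funext => v; rewrite mxE; apply: eq_bigr => j _; rewrite mxE; congr (_ * _).
    by apply: eq_bigr => i _; rewrite mxE mulrC.
  - apply: closed_bigI => j _; apply: cl; first exact: closed_eq.
    rewrite (_ : (fun _ => _) = fun v : 'rV[R]_(k * k) => \sum_i v 0 i * B i j).
      by apply: sum_continuous => i; apply: continuousMc; exact: coord_continuous.
    by apply/funext => v; rewrite mxE.
  - apply: cl; first exact: closed_eq.
    apply: sum_continuous => i.
    exact: vec_mx_entry_continuous.
move=> v /= [pv _ tv] l; case/mxvec_indexP: l => i j.
rewrite /= in_itv /= -ler_norml -tv.
by have := possemidef_entry_bound pv i j; rewrite mxE.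
Qed.

Lemma det_vec_mx_continuous (R : realType) k :
  continuous (fun v : 'rV[R]_(k * k) => \det (vec_mx v)).
Proof.
rewrite (_ : (fun _ => _) =
  fun v : 'rV[R]_(k * k) => \sum_(s : 'S_k) (\prod_i vec_mx v i (s i)) * (-1) ^+ s).
  apply: sum_continuous => s; apply: continuousMc; apply: prod_continuous => i.
  exact: vec_mx_entry_continuous.
by apply/funext => v; apply: eq_bigr => s _; rewrite mulrC.
Qed.

Lemma posdef_trace_gt0 (R : realType) k (A : 'M[R]_k) :
  (0 < k)%N -> posdef A -> 0 < \tr A.
Proof.
move=> k0 [_ pA].
have dA i : 0 < A i i.
  have := pA (delta_mx i 0); rewrite trmx_delta -rowE -colE !mxE; apply.
  by apply/eqP => /matrixP/(_ i 0)/eqP; rewrite !mxE !eqxx oner_eq0.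
rewrite /mxtrace (bigD1 (Ordinal k0)) //= ltr_pwDl // sumr_ge0 // => i _.
exact: ltW.
Qed.

Lemma det_max_on_slice (R : realType) k p (B : 'M[R]_(k * k, p)) : (0 < k)%N ->
  (exists2 A, posdef A & mxvec A *m B = 0) ->
  exists A, [/\ posdef A, mxvec A *m B = 0, \tr A = 1 &
    forall A', posdef A' -> mxvec A' *m B = 0 -> \tr A' = 1 -> \det A' <= \det A].
Proof.
move=> k0 [A0 pA0 A0B].
have t0 := posdef_trace_gt0 k0 pA0.
pose A1 := (\tr A0)^-1 *: A0.
have pA1 : posdef A1 by apply: posdef_scale; rewrite ?invr_gt0.
pose K := [set v : 'rV[R]_(k * k) |
    [/\ possemidef (vec_mx v), v *m B = 0 & \tr (vec_mx v) = 1]]%classic.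
have K1 : K (mxvec A1).
  split; rewrite ?mxvecK; first exact: posdef_semidef.
    by rewrite linearZ /= -scalemxAl A0B scaler0.
  by rewrite linearZ /= mulVf // gt_eqF.
have [v] := EVT_max_rV (ex_intro _ _ K1) (compact_possemidef_slice (B := B))
  (continuous_subspaceT (@det_vec_mx_continuous R k)).
rewrite inE => -[pv vB tv] maxv.
exists (vec_mx v); split; rewrite ?vec_mxK //.
  (* The maximal determinant is at least that of the normalised feasible point [A1], hence positive,
     so the semidefinite maximiser is definite. *)
  apply: possemidef_posdef => //; rewrite gt_eqF //.
  have := maxv _ (mem_set K1); rewrite mxvecK.
  by apply: lt_le_trans; exact: posdef_det_gt0.
move=> A' pA' A'B tA'; rewrite -(mxvecK A'); apply: maxv; rewrite inE.
by split; rewrite ?mxvecK //; exact: posdef_semidef.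
Qed.

(* [f(tA) = t \tr A - k ln t - ln det A] is least at [t = k / \tr A], so only the
   compact slice [\tr A = 1] matters. *)
Lemma trace_ln_det_min_id (R : realType) k p (B : 'M[R]_(k * k, p)) : (0 < k)%N ->
  (exists2 A, posdef A & mxvec A *m B = 0) ->
  exists A, [/\ posdef A, mxvec A *m B = 0 &
    forall A', posdef A' -> mxvec A' *m B = 0 ->
      \tr A - ln (\det A) <= \tr A' - ln (\det A')].
Proof.
move=> k0 /(det_max_on_slice k0) [A [pA AB tA maxA]].
have kR : 0 < k%:R :> R by rewrite ltr0n.
have lndetZ (c : R) (X : 'M[R]_k) : 0 < c -> posdef X ->
    ln (\det (c *: X)) = k%:R * ln c + ln (\det X).
  move=> c0 pX; rewrite detZ lnM ?posrE ?exprn_gt0 //; last exact: posdef_det_gt0.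
  by rewrite lnXn // mulr_natl.
exists (k%:R *: A); split; first exact: posdef_scale.
  by rewrite linearZ /= -scalemxAl AB scaler0.
move=> A' pA' A'B; have s0 := posdef_trace_gt0 k0 pA'.
rewrite lndetZ // linearZ /= tA mulr1; set s := \tr A' in s0 *.
have si0 : 0 < s^-1 by rewrite invr_gt0.
have : ln (\det (s^-1 *: A')) <= ln (\det A).
  rewrite ler_ln ?posrE; first last.
  - exact: posdef_det_gt0.
  - exact/posdef_det_gt0/posdef_scale.
  apply: maxA; first exact: posdef_scale.
    by rewrite linearZ /= -scalemxAl A'B scaler0.
  by rewrite linearZ /= mulVf // gt_eqF.
rewrite lndetZ // lnV ?posrE // => h1.
have : k%:R * ln (s / k%:R) <= s - k%:R.
  have -> : s - k%:R = k%:R * (s / k%:R - 1) by field; rewrite gt_eqF.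
  by rewrite ler_pM2l //; apply: ln_le_subr1; rewrite divr_gt0.
rewrite lnM ?lnV ?posrE ?invr_gt0 // mulrDr => h2; lra.
Qed.

(** Writing [S = C *m C^T], the substitution [A = F X] turns [\tr (A *m S)] into [\tr X] and shifts
    [ln det] by a constant, which reduces the problem to [S] the identity. *)
Lemma trace_ln_det_min (R : realType) k p (B : 'M[R]_(k * k, p)) (S : 'M[R]_k) :
  (0 < k)%N -> posdef S -> (exists2 A, posdef A & mxvec A *m B = 0) ->
  exists A, [/\ posdef A, mxvec A *m B = 0 &
    forall A', posdef A' -> mxvec A' *m B = 0 ->
      \tr (A *m S) - ln (\det A) <= \tr (A' *m S) - ln (\det A')].
Proof.
move=> k0 /posdef_factor [C uC ->] [A0 pA0 A0B].
pose D := invmx C^T; have uCT : C^T \in unitmx by rewrite unitmx_tr.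
have uD : D \in unitmx by rewrite unitmx_inv.
have DT : D^T = invmx C by rewrite /D -trmx_inv trmxK.
pose F (X : 'M[R]_k) := D *m X *m D^T; pose G (X : 'M[R]_k) := C^T *m X *m C^T^T.
have GK X : F (G X) = X.
  by rewrite /F /G DT trmxK !mulmxA mulVmx // mul1mx mulmxK.
(* [B'] is the linear constraint [B] pulled back along [F]. *)
pose B' := lin_mulmx D *m (lin_mulmxr D^T *m B).
have B'E X : mxvec X *m B' = mxvec (F X) *m B.
  by rewrite /B' mulmxA mul_vec_lin mulmxA mul_vec_lin.
have pG X : posdef X -> posdef (G X) by move=> pX; exact: posdef_congr.
have pF X : posdef X -> posdef (F X) by move=> pX; exact: posdef_congr.
have trF X : \tr (F X *m (C *m C^T)) = \tr X.
  rewrite /F DT mulmxA mulmxKV // mxtrace_mulC !mulmxA mulmxV //.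
  by rewrite mul1mx.
have [|X [pX XB minX]] := @trace_ln_det_min_id _ _ _ B' k0.
  by exists (G A0); [exact: pG | rewrite B'E GK].
exists (F X); split; [exact: pF|by rewrite -B'E|] => A' pA' A'B.
have := minX (G A'); rewrite B'E GK => /(_ (pG _ pA') A'B).
have lndetF Y : posdef Y -> ln (\det (F Y)) = ln (\det Y) + ln (\det D ^+ 2).
  by move=> pY; exact: ln_det_congr.
have := lndetF _ (pG _ pA'); have := lndetF _ pX; have := trF (G A').
rewrite GK trF; lra.
Qed.

(** * Uniqueness of the minimiser *)

Lemma trace_ln_det_min_unique (R : realType) k p (B : 'M[R]_(k * k, p))
    (S A1 A2 : 'M[R]_k) (f := fun A => \tr (A *m S) - ln (\det A)) :
  (forall A, posdef A -> mxvec A *m B = 0 -> f A1 <= f A) ->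
  (forall A, posdef A -> mxvec A *m B = 0 -> f A2 <= f A) ->
  posdef A1 -> mxvec A1 *m B = 0 -> posdef A2 -> mxvec A2 *m B = 0 -> A1 = A2.
Proof.
move=> min1 min2 p1 B1 p2 B2; apply: ln_det_midpoint => //.
have i2 : 0 < 2^-1 :> R by rewrite invr_gt0.
set M := _ + _.
have pM : posdef M by apply: posdef_comb => //; exact: ltW.
have BM : mxvec M *m B = 0.
  by rewrite linearD !linearZ /= mulmxDl -!scalemxAl B1 B2 !scaler0 addr0.
have trM : \tr (M *m S) = 2^-1 * \tr (A1 *m S) + 2^-1 * \tr (A2 *m S).
  by rewrite mulmxDl -!scalemxAl linearD !linearZ.
(* The trace term at [M] is the average of its values at [A1] and [A2], so adding the two minimality
   inequalities leaves exactly the hypothesis of [ln_det_midpoint]. *)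
have := min1 M pM BM; have := min2 M pM BM; rewrite /f trM; lra.
Qed.

(** * The map [Amap] on the orthogonal complement of its kernel *)

Lemma mxtrace_mul_tr (R : ringType) m n (A B : 'M[R]_(m, n)) :
  \tr (A *m B^T) = \sum_i \sum_j A i j * B i j.
Proof. by apply: eq_bigr => i _; rewrite mxE; apply: eq_bigr => j _; rewrite mxE. Qed.

Lemma mxvec_mul_tr (R : ringType) m n (A B : 'M[R]_(m, n)) :
  (mxvec A *m (mxvec B)^T) 0 0 = \tr (A *m B^T).
Proof.
rewrite mxtrace_mul_tr mxE pair_bigA /=.
rewrite (reindex _ (curry_mxvec_bij m n)) /=; apply: eq_bigr => -[i j] _ /=.
by rewrite mxE !mxvecE.
Qed.

Lemma mxtrace_sqr_eq0 (R : realDomainType) m n (A : 'M[R]_(m, n)) :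
  \tr (A *m A^T) <= 0 -> A = 0.
Proof.
have sq0 i j : 0 <= A i j * A i j by rewrite -expr2 sqr_ge0.
have row0 i : 0 <= \sum_j A i j * A i j by exact: sumr_ge0.
rewrite mxtrace_mul_tr => le0.
have e : \sum_i \sum_j A i j * A i j = 0.
  by apply/eqP; rewrite eq_le le0 sumr_ge0.
apply/matrixP => i j; rewrite [RHS]mxE.
have ei : \sum_j A i j * A i j = 0 by apply: (psumr_eq0P (fun i _ => row0 i) e).
have /eqP : A i j * A i j = 0 by apply: (psumr_eq0P (fun j _ => sq0 i j) ei).
by rewrite mulf_eq0 orbb => /eqP.
Qed.

(** If [K] spans the right kernel of [G^T *m G], then [G *m K] has zero Frobenius norm, so [K] is
    annihilated by [G] as well. *)
Lemma submx_gram (R : realFieldType) m n (G : 'M[R]_(m, n)) : (G <= G^T *m G)%MS.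
Proof.
rewrite submxE; set K := cokermx _; apply/eqP/mxtrace_sqr_eq0.
rewrite mxtrace_mulC trmx_mul -mulmxA (mulmxA G^T) mulmx_coker mulmx0.
by rewrite linear0.
Qed.

Section Amap.
Variables (R : realType) (m n N : nat).
Local Notation Amap := (@Amap R m n N).
Local Notation b := (m * N)%N.
Local Notation a := (m * n.+1)%N.

Lemma Amap_linear c L L' T T' :
  Amap (c *: L + L') (c *: T + T') = c *: Amap L T + Amap L' T'.
Proof.
rewrite /Defs.Amap !mulmxDr !mulmxDl -!scalemxAr -!scalemxAl !scalerDr scalerN.
by rewrite opprD [X in X + _ = _]addrACA [LHS]addrACA.
Qed.

(** Symmetrising the arguments presents [Amap] on symmetric pairs as a linear map on a full space of
    row vectors; on pairs already symmetric it gives twice [Amap]. *)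
Definition sym_Amap (v : 'rV[R]_(a * a + b * b)) : 'rV[R]_(b * b) :=
  let L := vec_mx (lsubmx v) in let T := vec_mx (rsubmx v) in
  mxvec (Amap (L + L^T) (T + T^T)).

Lemma sym_Amap_linear : linear sym_Amap.
Proof.
move=> c u v; rewrite /sym_Amap /=.
have symP k (X Y : 'M[R]_k) :
    c *: X + Y + (c *: X + Y)^T = c *: (X + X^T) + (Y + Y^T).
  have -> : (c *: X + Y)^T = c *: X^T + Y^T by exact: linearP.
  by rewrite scalerDr addrACA.
have -> : lsubmx (c *: u + v) = c *: lsubmx u + lsubmx v by exact: linearP.
have -> : rsubmx (c *: u + v) = c *: rsubmx u + rsubmx v by exact: linearP.
by rewrite ![vec_mx (_ + _)]linearP !symP Amap_linear linearP.
Qed.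
HB.instance Definition _ := GRing.isLinear.Build R _ _ _ sym_Amap sym_Amap_linear.

Lemma sym_Amap_row L T : symmx L -> symmx T ->
  sym_Amap (row_mx (mxvec L) (mxvec T)) = 2 *: mxvec (Amap L T).
Proof.
move=> sL sT; rewrite /sym_Amap row_mxKl row_mxKr !mxvecK sL sT.
have := Amap_linear 1 L L T T; rewrite !scale1r => ->.
by rewrite linearD /= scaler_nat mulr2n.
Qed.

(* The range of [Amap] on symmetric pairs is already attained on the orthogonal
   complement of its kernel, since [G] and [G^T *m G] have the same row space. *)
Lemma Amap_range : exists B : 'M[R]_(b * b),
  (forall L T, symmx L -> symmx T -> mxvec (Amap L T) *m B = 0) /\
  (forall M, mxvec M *m B = 0 -> exists L T, in_ker_perp L T /\ Amap L T = M).
Proof.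
pose G := lin1_mx sym_Amap; exists (cokermx G).
split=> [L T sL sT|M /eqP].
  apply/eqP; rewrite -submxE.
  apply/submxP; exists (2^-1 *: row_mx (mxvec L) (mxvec T)).
  by rewrite -scalemxAl mul_rV_lin1 /= sym_Amap_row // scalerA mulVf ?scale1r.
rewrite -submxE => /submx_trans/(_ (submx_gram G))/submxP[u].
rewrite mulmxA; set w := u *m G^T; rewrite mul_rV_lin1 /= => eM.
pose P := vec_mx (lsubmx w) : 'M[R]_a; pose Q := vec_mx (rsubmx w) : 'M[R]_b.
exists (P + P^T), (Q + Q^T); split; last by apply: (can_inj mxvecK); rewrite eM.
split; first by rewrite /symmx linearD /= trmxK addrC.
split; first by rewrite /symmx linearD /= trmxK addrC.
move=> L' T' sL sT A0.
have tr2 k (X Y : 'M[R]_k) : symmx Y -> \tr ((X + X^T) *m Y) = 2 * \tr (X *m Y^T).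
  move=> sY; rewrite mulmxDl linearD /= mulr_natl mulr2n sY; congr (_ + _).
  by rewrite -mxtrace_tr trmx_mul trmxK sY mxtrace_mulC.
rewrite !tr2 // -mulrDr; pose w' := row_mx (mxvec L') (mxvec T').
(* Since [w = u *m G^T], this pairing is [u *m (w' *m G)^T], and [w' *m G] is twice the flattened
   [Amap L' T'], which is 0. *)
suff -> : \tr (P *m L'^T) + \tr (Q *m T'^T) = (w *m w'^T) 0 0.
  rewrite /w -mulmxA -trmx_mul mul_rV_lin1 /= sym_Amap_row // A0.
  by rewrite !linear0 mxE mulr0.
rewrite -!mxvec_mul_tr !vec_mxK /w' tr_row_mx -[w in RHS]hsubmxK mul_row_col.
by rewrite [RHS]mxE.
Qed.

(** The difference of the two pairs lies in the kernel and is orthogonal to it, so its squared norm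
    is 0. *)
Lemma Amap_inj_perp L L' T T' : in_ker_perp L T -> in_ker_perp L' T' ->
  Amap L T = Amap L' T' -> L = L' /\ T = T'.
Proof.
move=> [sL [sT kLT]] [sL' [sT' kLT']] eA.
have sD k (X Y : 'M[R]_k) : symmx X -> symmx Y -> symmx (X - Y).
  by rewrite /symmx linearB /= => -> ->.
have A0 : Amap (L - L') (T - T') = 0.
  have := Amap_linear (-1) L' L T' T.
  by rewrite eA !scaleN1r addNr (addrC _ L) (addrC _ T).
have := kLT _ _ (sD _ _ _ sL sL') (sD _ _ _ sT sT') A0.
have := kLT' _ _ (sD _ _ _ sL sL') (sD _ _ _ sT sT') A0.
have sq k (X : 'M[R]_k) : 0 <= \tr (X *m X^T).
  rewrite mxtrace_mul_tr; do 2!apply: sumr_ge0 => ? _.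
  by rewrite -expr2 sqr_ge0.
move=> h' h; have [hL hT] := (sq _ (L - L'), sq _ (T - T')).
have s0 : \tr ((L - L') *m (L - L')^T) + \tr ((T - T') *m (T - T')^T) = 0.
  have trB k (X Y : 'M[R]_k) : symmx X -> symmx Y ->
      \tr ((X - Y) *m (X - Y)^T) = \tr (X *m (X - Y)) - \tr (Y *m (X - Y)).
    by move=> sX sY; rewrite (sD _ _ _ sX sY) mulmxBl linearB.
  by rewrite !trB // addrACA -opprD h h' subr0.
by split; apply/eqP; rewrite -subr_eq0; apply/eqP/mxtrace_sqr_eq0; lra.
Qed.

(** By cyclicity of the trace, shift invariance of [Sb] cancels the two [T] terms; this makes the
    objective a function of [Amap L T] alone. *)
Lemma trace_Amap (Sb : 'M[R]_b) L T : (Umat R m N)^T *m Sb *m Umat R m N = Sb ->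
  \tr (L *m ((Emat R m n N)^T *m Sb *m Emat R m n N)) = \tr (Amap L T *m Sb).
Proof.
move=> eU; rewrite /Defs.Amap mulmxBl mulmxDl linearB linearD /=.
set E := Emat _ _ _ _; set U := Umat _ _ _ in eU *.
have -> : \tr (U *m T *m U^T *m Sb) = \tr (T *m Sb).
  by rewrite -!mulmxA mxtrace_mulC -!mulmxA (mulmxA U^T) eU.
by rewrite addrK -[in RHS]mulmxA -[in RHS]mulmxA [RHS]mxtrace_mulC !mulmxA.
Qed.

End Amap.

(** * Feasibility: the identity as a value of [Amap] *)

Lemma mulmx_select_diag (R : comRingType) p q (s : 'I_p -> 'I_q) (d : 'I_q -> R) :
  let U := \matrix_(i, k) (k == s i)%:R in
  U *m (\matrix_(i, j) ((i == j)%:R * d i)) *m U^T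
    = \matrix_(i, j) ((s i == s j)%:R * d (s i)).
Proof.
move=> U; apply/matrixP => i j; rewrite !mxE (bigD1 (s j)) //= big1 => [|k kj].
  rewrite !mxE eqxx mulr1 addr0 (bigD1 (s i)) //= big1 => [|k ki].
    by rewrite !mxE eqxx mul1r addr0.
  by rewrite !mxE (negbTE ki) mul0r.
by rewrite !mxE (negbTE kj) mulr0.
Qed.

(** Conjugation by [Emat] pads with zeros, which agrees with the larger diagonal matrix because [d]
    vanishes beyond the first [n.+1] blocks. *)
Lemma mul_Emat_diag (R : realType) m n N (d : nat -> R) : (n.+1 <= N)%N ->
  (forall i, (m * n.+1 <= i)%N -> d i = 0) ->
  Emat R m n N *m (\matrix_(i, j) ((i == j)%:R * d i)) *m (Emat R m n N)^T
    = \matrix_(i, j) ((i == j)%:R * d i).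
Proof.
move=> nN d0; have le_mN : (m * n.+1 <= m * N)%N by rewrite leq_mul2l nN orbT.
apply/matrixP => i j; rewrite !mxE.
have inner (l : 'I_(m * n.+1)) :
    (Emat R m n N *m (\matrix_(i, j) ((i == j)%:R * d i))) i l = (i == l :> nat)%:R * d i.
  rewrite mxE (bigD1 l) //= big1 => [|k kl].
    by rewrite !mxE eqxx mul1r addr0; case: (nat_of_ord i =P l) => [->|]; rewrite ?mul0r.
  by rewrite !mxE (negbTE kl) mul0r mulr0.
under eq_bigr => l _ do rewrite inner !mxE.
have [im|im] := ltnP i (m * n.+1); last first.
  by rewrite d0 // mulr0; apply: big1 => l _; rewrite mulr0 mul0r.
rewrite (bigD1 (Ordinal im)) //= big1 => [|l li].
  by rewrite eqxx mul1r addr0 mulrC (eq_sym (nat_of_ord j)).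
by move: li; rewrite -val_eqE /= eq_sym => /negbTE ->; rewrite !mul0r.
Qed.

Section BlockShift.
Variables (m N : nat) (m0 : (0 < m)%N) (N0 : (0 < N)%N).

Lemma block_shift_subproof (i : 'I_(m * N)) :
  (((i %/ m).+1 %% N) * m + i %% m < m * N)%N.
Proof.
have := ltn_pmod (i %/ m).+1 N0; have := ltn_pmod i m0.
set r := (_ %% m)%N; set q := (_ %% N)%N => rm qN.
apply: (@leq_trans (q.+1 * m)); first by rewrite mulSn addnC ltn_add2r.
by rewrite [(m * N)%N]mulnC leq_mul2r qN orbT.
Qed.
(** The permutation of scalar indices whose permutation matrix is [Umat]: it moves to the next block
    cyclically and keeps the position inside the block. *)
Definition block_shift i := Ordinal (block_shift_subproof i).

Lemma block_shift_div i : (block_shift i %/ m = (i %/ m).+1 %% N)%N.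
Proof. by rewrite divnMDl // (divn_small (ltn_pmod _ m0)) addn0. Qed.

Lemma block_shift_mod i : (block_shift i %% m = i %% m)%N.
Proof. by rewrite modnMDl modn_mod. Qed.

Lemma block_shift_inj : injective block_shift.
Proof.
move=> i j e; apply/val_inj; rewrite /= (divn_eq i m) (divn_eq j m).
rewrite -(block_shift_mod i) -(block_shift_mod j) e; congr (_ * _ + _)%N.
have : ((i %/ m).+1 %% N = (j %/ m).+1 %% N)%N by rewrite -!block_shift_div e.
have lt (l : 'I_(m * N)) : (l %/ m < N)%N.
  by rewrite ltn_divLR // [X in (_ < X)%N]mulnC.
move/eqP; rewrite -(addn1 (i %/ m)) -(addn1 (j %/ m)) eqn_modDr !modn_small //; exact/eqP.
Qed.

Lemma UmatE (R : realType) : Umat R m N = \matrix_(i, k) (k == block_shift i)%:R.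
Proof.
apply/matrixP => i k; rewrite !mxE; congr (_%:R); congr nat_of_bool.
apply/andP/eqP => [[/eqP r /eqP q]|->].
  by apply/val_inj; rewrite /= -q r -divn_eq.
by rewrite block_shift_div block_shift_mod !eqxx.
Qed.

End BlockShift.

(* With 0-based block index q, take Lambda = N on block 0 and
   Theta = q - N * [q > 0]: each cyclic difference of Theta is 1, except for
   1 - N at block 0, which Lambda compensates. *)
Lemma Amap_feasible (R : realType) (m n N : nat) :
  (0 < m)%N -> (1 < N)%N -> (n < N)%N ->
  exists (L : 'M[R]_(m * n.+1)) (T : 'M[R]_(m * N)),
    [/\ symmx L, symmx T & Amap L T = 1%:M].
Proof.
move=> m0 N1 nN; have N0 : (0 < N)%N by apply: ltnW.
pose d (i : nat) : R := N%:R * (i < m)%N%:R.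
pose t (i : nat) : R := (i %/ m)%:R - N%:R * (0 < i %/ m)%N%:R.
have sym k (f : nat -> R) : symmx (\matrix_(i < k, j < k) ((i == j)%:R * f i)).
  by apply/matrixP => i j; rewrite !mxE eq_sym; case: eqP => [->|]; rewrite ?mul0r.
exists (\matrix_(i, j) ((i == j)%:R * d i)), (\matrix_(i, j) ((i == j)%:R * t i)).
split=> //; rewrite /Amap mul_Emat_diag // => [|i hi]; last first.
  by rewrite /d ltnNge (leq_trans _ hi) ?mulr0 // leq_pmulr.
rewrite (UmatE m0 N0) (mulmx_select_diag _ (fun k => t k)).
apply/matrixP => i j; rewrite !mxE (inj_eq (@block_shift_inj _ _ m0 N0)).
case: eqP => _ /=; last by rewrite !mul0r addr0 subr0.
rewrite !mul1r /t block_shift_div // /d.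
have -> : (i < m)%N = (i %/ m < 1)%N by rewrite ltn_divLR // mul1n.
have : (i %/ m < N)%N by rewrite ltn_divLR // [X in (_ < X)%N]mulnC.
(* Block 0 steps to block 1 because [1 < N]; a later block either steps to its successor or, if it
   is the last, wraps around to block 0. *)
case: (i %/ m)%N => [|q] qN; first by rewrite modn_small //=; lra.
rewrite /= mulr0 add0r; case: (ltnP q.+2 N) => [qN'|Nq].
  by rewrite modn_small //= -[q.+2]addn1 natrD; lra.
have -> : N = q.+2 by apply/eqP; rewrite eqn_leq Nq.
by rewrite modnn /= -[q.+2]addn1 natrD; lra.
Qed.

Lemma posdef1 (R : realType) k : posdef (1%:M : 'M[R]_k).
Proof.
split=> [|x x0]; first exact: trmx1.
rewrite mulmx1 lt_neqAle; apply/andP; split; last first.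
  by rewrite mxE sumr_ge0 // => i _; rewrite mxE -expr2 sqr_ge0.
apply: contra_neq x0 => e; apply/(can_inj (@trmxK _ _ _)); rewrite linear0.
by apply: mxtrace_sqr_eq0; rewrite trmxK /mxtrace big_ord1 -e.
Qed.

(** * Transfer from matrices in the range of [Amap] back to pairs *)

Theorem theorem6 (R : realType) (m n N : nat)
  (hm : (1 <= m)%N) (hn : (1 <= n)%N) (hN : (2 * n < N)%N)
  (Sigma : 'I_n.+1 -> 'M[R]_m) :
  (exists Sb : 'M[R]_(m * N),
      posdef Sb /\
      (Emat R m n N)^T *m Sb *m Emat R m n N = Toep Sigma /\
      (Umat R m N)^T *m Sb *m Umat R m N = Sb) ->
  exists! LT : 'M[R]_(m * n.+1) * 'M[R]_(m * N),
    Lplus LT.1 LT.2 /\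
    forall (L : 'M[R]_(m * n.+1)) (T : 'M[R]_(m * N)),
      Lplus L T ->
      Jfun (Toep Sigma) LT.1 LT.2 <= Jfun (Toep Sigma) L T.
Proof.
move=> [Sb [pSb [<- shiftSb]]].
have nN : (n < N)%N by apply: leq_ltn_trans hN; rewrite leq_pmull.
have N1 : (1 < N)%N by apply: leq_ltn_trans hn nN.
have mN0 : (0 < m * N)%N by rewrite muln_gt0 hm ltnW.
have [B [symB rangeB]] := Amap_range R m n N.
have JE (L : 'M[R]_(m * n.+1)) (T : 'M[R]_(m * N)) :
    Jfun ((Emat R m n N)^T *m Sb *m Emat R m n N) L T
    = \tr (Amap L T *m Sb) - ln (\det (Amap L T)).
  by rewrite /Jfun (trace_Amap _ T shiftSb).
have LplusB (L : 'M[R]_(m * n.+1)) (T : 'M[R]_(m * N)) :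
    Lplus L T -> mxvec (Amap L T) *m B = 0.
  by move=> [[sL [sT _]] _]; exact: symB.
have [|A [pA AB minA]] := @trace_ln_det_min _ _ _ B _ mN0 pSb.
  exists 1%:M; first exact: posdef1.
  by have [L [T [sL sT <-]]] := Amap_feasible R hm N1 nN; exact: symB.
have /rangeB [L0 [T0 [kLT0 A0]]] := AB.
exists (L0, T0); split=> /=; first split.
- by split=> //; rewrite A0.
- by move=> L T LT; rewrite !JE A0; apply: minA; [case: LT | exact: LplusB].
move=> [L1 T1] /= [LT1 min1]; have [kLT1 pA1] := LT1.
(* Injectivity of [Amap] on the orthogonal complement of its kernel reduces uniqueness of the pair
   to uniqueness of its image. *)
suff eA : A = Amap L1 T1.
  by have [-> ->] := Amap_inj_perp kLT0 kLT1 (etrans A0 eA).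
(* Each competing matrix [A'] lifts to a pair in [Lplus], so minimality of [(L1, T1)] among pairs
   becomes minimality of its image among matrices. *)
apply: (trace_ln_det_min_unique minA _ pA AB pA1 (LplusB _ _ LT1)) => A' pA' /rangeB.
move=> [L' [T' [kLT' eA']]]; rewrite -eA' -!JE; apply: min1.
by split=> //; rewrite eA'.
Qed.
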